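(* For $1\le i\le 8$ let $C_i^{(\mathrm{N1})}=V(Q^{(\mathrm{N1})},P_i^{(\mathrm{N1})})\subset\mathbb{P}^3$ be the superspecial curve of genus $4$ over $\mathbb{F}_{11}$ defined by $Q^{(\mathrm{N1})}=2xw+2yz$ and the cubic form $P_i^{(\mathrm{N1})}$ listed in the context. Then (1) $\operatorname{Aut}_{\mathbb{F}_{11}}(C_1^{(\mathrm{N1})})\cong \mathrm{C}_6$; (2) $\operatorname{Aut}_{\mathbb{F}_{11}}(C_2^{(\mathrm{N1})})\cong \mathrm{C}_2$; (3) $\operatorname{Aut}_{\mathbb{F}_{11}}(C_3^{(\mathrm{N1})})\cong \mathrm{D}_4$; (4) $\operatorname{Aut}_{\mathbb{F}_{11}}(C_4^{(\mathrm{N1})})\cong \mathrm{C}_2$; (5) $\operatorname{Aut}_{\mathbb{F}_{11}}(C_5^{(\mathrm{N1})})\cong \mathrm{C}_3$; (6) $\operatorname{Aut}_{\mathbb{F}_{11}}(C_6^{(\mathrm{N1})})\cong \mathrm{C}_2\times\mathrm{C}_2$; (7) $\operatorname{Aut}_{\mathbb{F}_{11}}(C_7^{(\mathrm{N1})})\cong \mathrm{D}_6$; (8) $\operatorname{Aut}_{\mathbb{F}_{11}}(C_8^{(\mathrm{N1})})\cong \mathrm{S}_4$.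
   Context: $\mathrm{C}_n$ is the cyclic group of order $n$, $\mathrm{D}_n$ the dihedral group of degree $n$ (order $2n$), $\mathrm{S}_n$ the symmetric group of degree $n$. The cubic forms in $\mathbb{F}_{11}[x,y,z,w]$ are: $P_1^{(\mathrm{N1})}=x^2y+x^2z+2y^2z+5y^2w+9yz^2+yzw+4z^3+3z^2w+10zw^2+w^3$, $P_2^{(\mathrm{N1})}=x^2y+x^2z+y^3+y^2z+7yz^2+4yw^2+2z^3+9zw^2$, $P_3^{(\mathrm{N1})}=x^2y+x^2z+y^3+8y^2z+3yz^2+10yw^2+10z^3+10zw^2$, $P_4^{(\mathrm{N1})}=x^2y+x^2z+y^3+9y^2z+2y^2w+3yz^2+3yzw+4yw^2+10z^3+2z^2w+6zw^2$, $P_5^{(\mathrm{N1})}=x^2y+x^2z+xz^2+10y^2w+9yz^2+9yw^2+8z^3+8z^2w+8zw^2+3w^3$, $P_6^{(\mathrm{N1})}=x^2y+x^2z+xz^2+9y^2z+5y^2w+yzw+8yw^2+3z^3+9z^2w+2zw^2+5w^3$, $P_7^{(\mathrm{N1})}=x^2y+x^2z+xz^2+4y^3+2y^2z+10y^2w+3yz^2+8yzw+8yw^2+8z^3+7z^2w+7zw^2+4w^3$, $P_8^{(\mathrm{N1})}=x^2y+x^2z+xz^2+9y^3+6y^2z+5y^2w+8yz^2+5yzw+2yw^2+z^3+2z^2w+7zw^2+w^3$. These curves are known to be nonsingular nonhyperelliptic superspecial curves of genus $4$ (canonically embedded). A curve is superspecial if its Jacobian is isomorphic over the algebraic closure to a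 product of supersingular elliptic curves. For $C=V(Q,P)$ over a field $K$, $\operatorname{Aut}_K(C)$ is the group of automorphisms of $C$ defined over $K$. It is described as $\operatorname{Aut}_K(C)=G_K/{\sim}$, where, with $\varphi$ the symmetric coefficient matrix of $Q$, $G_K=\{g\in \mathrm{GL}_4(K): {}^tg\varphi g=\mu\varphi\text{ for some }\mu\in K^\times,\ g\cdot P\equiv rP \bmod Q\text{ for some } r\in K^\times\}$, $g\cdot P:=P((x,y,z,w)\cdot{}^tg)$, and $g\sim cg$ for $c\in K^\times$. *)

(* Defs.v *)
From HB Require Import structures.
From mathcomp Require Import all_boot all_algebra all_fingroup all_solvable.
From mathcomp Require Import boolp mpoly.

Set Implicit Arguments.
Unset Strict Implicit.
Unset Printing Implicit Defensive.

Import GRing.Theory.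
Local Open Scope ring_scope.

Section AutomorphismGroup.
Variable K : finFieldType.
Implicit Types (g : {'GL_4[K]}) (Q P : {mpoly K[4]}).

(* The half on the off-diagonal entries makes sense in characteristic <> 2
   only, which is the case of interest. *)
Definition coef_mx Q : 'M[K]_4 :=
  \matrix_(i, j) ((if i == j then 1 else 2^-1) * Q@_(U_(i) + U_(j))).

Definition quad_form (phi : 'M[K]_4) : {mpoly K[4]} :=
  \sum_(i < 4) \sum_(j < 4) phi i j *: ('X_i * 'X_j).

(* The j-th coordinate of the row vector (x, y, z, w) *m A^T is
   \sum_k A j k *: 'X_k. *)
Definition mx_subst (A : 'M[K]_4) P : {mpoly K[4]} :=
  P \mPo [tuple \sum_(k < 4) A j k *: 'X_k | j < 4].

(* Membership in the ideal (Q) of K[x, y, z, w] is a Prop; it is turned into a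
   boolean (by asbool) so that the similitudes form a finite set. *)
Definition preserves_curve Q P g : Prop :=
  let phi := coef_mx Q in
  (exists2 mu : K, mu != 0 &
     (GLval g)^T *m phi *m GLval g = mu *: phi) /\
  (exists2 r : K, r != 0 &
     exists L : {mpoly K[4]}, mx_subst (GLval g) P - r *: P = L * Q).

Definition lin_aut Q P : {set {'GL_4[K]}} := [set g | `[< preserves_curve Q P g >]].

Definition scalars : {set {'GL_4[K]}} := [set g | is_scalar_mx (GLval g)].

Lemma scalars_group_set : group_set scalars.
Proof.
apply/group_setP; split; first by rewrite inE; exact: scalar_mx_is_scalar.
move=> g h; rewrite !inE => /is_scalar_mxP[a ga] /is_scalar_mxP[b hb].
by apply/is_scalar_mxP; exists (a * b); rewrite scalar_mxM -ga -hb.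
Qed.
Canonical scalars_group := Group scalars_group_set.

(* Scalar matrices are central, so no element of lin_aut Q P is lost when the
   quotient restricts to the normaliser of scalars. *)
Definition curve_aut Q P : {set coset_of scalars} := (lin_aut Q P / scalars)%g.

Lemma scalars_central g c : c \in scalars -> commute g c.
Proof.
rewrite inE => /is_scalar_mxP[a ca]; apply/val_inj.
change (GLval g *m GLval c = GLval c *m GLval g).
by rewrite ca; exact: scalar_mxC.
Qed.

Lemma norm_scalars (A : {set {'GL_4[K]}}) : A \subset ('N(scalars))%g.
Proof.
apply: subset_trans (cent_sub _); apply/subsetP => g _.
by apply/centP => c cS; exact: scalars_central.
Qed.

Lemma mx_substM (A B : 'M[K]_4) P :
  mx_subst (A *m B) P = mx_subst B (mx_subst A P).
Proof.
rewrite /mx_subst [LHS]comp_mpolyEX [X in _ = X \mPo _]comp_mpolyEX raddf_sum /=.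
apply: eq_bigr => m _.
rewrite !comp_mpolyZ !comp_mpolyX rmorph_prod /=; congr (_ *: _).
apply: eq_bigr => i _; rewrite rmorphXn /=; congr (_ ^+ _).
rewrite !tnth_mktuple raddf_sum /=.
under [RHS]eq_bigr => l _.
  rewrite comp_mpolyZ comp_mpolyXU -tnth_nth tnth_mktuple scaler_sumr.
  over.
rewrite exchange_big /=; apply: eq_bigr => k _.
rewrite mxE scaler_suml; apply: eq_bigr => l _.
by rewrite scalerA.
Qed.

Lemma mx_subst1 P : mx_subst 1%:M P = P.
Proof.
rewrite /mx_subst -[RHS]comp_mpoly_id; congr (_ \mPo _).
apply: eq_from_tnth => j; rewrite !tnth_mktuple (bigD1 j) //= mxE eqxx scale1r.
by rewrite big1 ?addr0 // => k kj; rewrite mxE eq_sym (negPf kj) scale0r.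
Qed.

Lemma mx_subst_quad A phi : mx_subst A (quad_form phi) = quad_form (A^T *m phi *m A).
Proof.
rewrite /quad_form /mx_subst !raddf_sum /=.
transitivity (\sum_(i < 4) \sum_(j < 4) \sum_(k < 4) \sum_(l < 4)
   (A i k * phi i j * A j l) *: ('X_k * 'X_l) : {mpoly K[4]}).
  apply: eq_bigr => i _; rewrite raddf_sum; apply: eq_bigr => j _ /=.
  rewrite comp_mpolyZ rmorphM /= !comp_mpolyXU -!tnth_nth !tnth_mktuple.
  rewrite mulr_suml scaler_sumr; apply: eq_bigr => k _.
  rewrite mulr_sumr scaler_sumr; apply: eq_bigr => l _.
  rewrite -scalerAl -scalerAr !scalerA; congr (_ *: _).
  by rewrite [phi i j * _]mulrC.
under [LHS]eq_bigr => i _ do rewrite exchange_big /=.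
rewrite exchange_big /=; apply: eq_bigr => k _.
under [LHS]eq_bigr => i _ do rewrite exchange_big /=.
rewrite exchange_big /=; apply: eq_bigr => l _.
rewrite exchange_big /= mxE scaler_suml; apply: eq_bigr => j _.
rewrite mxE mulr_suml scaler_suml; apply: eq_bigr => i _.
by rewrite mxE.
Qed.

Lemma quad_formZ c phi : quad_form (c *: phi) = c *: quad_form phi.
Proof.
rewrite /quad_form scaler_sumr; apply: eq_bigr => i _.
by rewrite scaler_sumr; apply: eq_bigr => j _; rewrite mxE scalerA.
Qed.

Lemma quad_form_anti :
  quad_form (\matrix_(i, j) (if (i + j == 3)%N then 1 else 0)) =
  2 *: ('X_0 * 'X_3) + 2 *: ('X_1 * 'X_2).
Proof.
rewrite /quad_form.
transitivity (\sum_(i < 4) 'X_i * 'X_(rev_ord i) : {mpoly K[4]}).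
  apply: eq_bigr => i _; rewrite (bigD1 (rev_ord i)) //= mxE.
  rewrite ifT; last by case: i => [[|[|[|[|//]]]] ?].
  rewrite scale1r big1 ?addr0 // => j ji; rewrite mxE ifF ?scale0r //.
  by move: ji; case: i j => [[|[|[|[|//]]]] ?] [[|[|[|[|//]]]] ?].
have -> (F : 'I_4 -> {mpoly K[4]}) : \sum_i F i = F 0 + F 1 + F 2 + F 3.
  rewrite !big_ord_recr big_ord0 /= add0r.
  by congr (F _ + F _ + F _ + F _); apply/val_inj.
have -> : rev_ord 0 = 3 :> 'I_4 by apply/val_inj.
have -> : rev_ord 1 = 2 :> 'I_4 by apply/val_inj.
have -> : rev_ord 2 = 1 :> 'I_4 by apply/val_inj.
have -> : rev_ord 3 = 0 :> 'I_4 by apply/val_inj.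
rewrite !scaler_nat (mulr2n ('X_0 * _)) (mulr2n ('X_1 * _)).
rewrite (mulrC 'X_2) (mulrC 'X_3).
by rewrite addrAC -!addrA; congr (_ + _); rewrite addrC -!addrA.
Qed.

Lemma lin_aut_group_set Q P :
  quad_form (coef_mx Q) = Q -> group_set (lin_aut Q P).
Proof.
move=> defQ; apply/group_setP; split.
  rewrite inE; apply/asboolP; split; exists 1; rewrite ?oner_eq0 //.
    by rewrite scale1r /= trmx1 mul1mx mulmx1.
  by exists 0; rewrite scale1r mul0r /= mx_subst1 subrr.
move=> g h; rewrite !inE => /asboolP[[a a0 ga] [r r0 [L gr]]].
move=> /asboolP[[b b0 hb] [s s0 [M hs]]]; apply/asboolP; split.
  exists (a * b); rewrite ?mulf_neq0 //= trmx_mul.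
  rewrite !mulmxA -2!(mulmxA (GLval h)^T) ga -scalemxAr -scalemxAl hb.
  by rewrite scalerA.
exists (r * s); rewrite ?mulf_neq0 //=.
exists (b *: mx_subst (GLval h) L + r *: M); rewrite mx_substM.
move/eqP: gr; rewrite subr_eq => /eqP->; move/eqP: hs; rewrite subr_eq => /eqP hs.
rewrite {1}/mx_subst comp_mpolyD comp_mpolyZ -!/(mx_subst _ _) hs.
have -> : mx_subst (GLval h) (L * Q) = mx_subst (GLval h) L * (b *: Q).
  rewrite /mx_subst rmorphM /= -!/(mx_subst _ _); congr (_ * _).
  by rewrite -{1}defQ mx_subst_quad hb quad_formZ defQ.
by rewrite scalerDr scalerA addrA addrK mulrDl -scalerAl -scalerAr -scalerAl.
Qed.

End AutomorphismGroup.

Section Curves.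

Local Notation x := ('X_0 : {mpoly 'F_11[4]}).
Local Notation y := ('X_1 : {mpoly 'F_11[4]}).
Local Notation z := ('X_2 : {mpoly 'F_11[4]}).
Local Notation w := ('X_3 : {mpoly 'F_11[4]}).

Definition QN1 : {mpoly 'F_11[4]} := 2 *: (x * w) + 2 *: (y * z).

Definition P1N1 : {mpoly 'F_11[4]} :=
  x ^+ 2 * y + x ^+ 2 * z + 2 *: (y ^+ 2 * z) + 5 *: (y ^+ 2 * w)
  + 9 *: (y * z ^+ 2) + y * z * w + 4 *: z ^+ 3 + 3 *: (z ^+ 2 * w)
  + 10 *: (z * w ^+ 2) + w ^+ 3.

Definition P2N1 : {mpoly 'F_11[4]} :=
  x ^+ 2 * y + x ^+ 2 * z + y ^+ 3 + y ^+ 2 * z + 7 *: (y * z ^+ 2)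
  + 4 *: (y * w ^+ 2) + 2 *: z ^+ 3 + 9 *: (z * w ^+ 2).

Definition P3N1 : {mpoly 'F_11[4]} :=
  x ^+ 2 * y + x ^+ 2 * z + y ^+ 3 + 8 *: (y ^+ 2 * z) + 3 *: (y * z ^+ 2)
  + 10 *: (y * w ^+ 2) + 10 *: z ^+ 3 + 10 *: (z * w ^+ 2).

Definition P4N1 : {mpoly 'F_11[4]} :=
  x ^+ 2 * y + x ^+ 2 * z + y ^+ 3 + 9 *: (y ^+ 2 * z) + 2 *: (y ^+ 2 * w)
  + 3 *: (y * z ^+ 2) + 3 *: (y * z * w) + 4 *: (y * w ^+ 2) + 10 *: z ^+ 3
  + 2 *: (z ^+ 2 * w) + 6 *: (z * w ^+ 2).

Definition P5N1 : {mpoly 'F_11[4]} :=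
  x ^+ 2 * y + x ^+ 2 * z + x * z ^+ 2 + 10 *: (y ^+ 2 * w)
  + 9 *: (y * z ^+ 2) + 9 *: (y * w ^+ 2) + 8 *: z ^+ 3 + 8 *: (z ^+ 2 * w)
  + 8 *: (z * w ^+ 2) + 3 *: w ^+ 3.

Definition P6N1 : {mpoly 'F_11[4]} :=
  x ^+ 2 * y + x ^+ 2 * z + x * z ^+ 2 + 9 *: (y ^+ 2 * z)
  + 5 *: (y ^+ 2 * w) + y * z * w + 8 *: (y * w ^+ 2) + 3 *: z ^+ 3
  + 9 *: (z ^+ 2 * w) + 2 *: (z * w ^+ 2) + 5 *: w ^+ 3.

Definition P7N1 : {mpoly 'F_11[4]} :=
  x ^+ 2 * y + x ^+ 2 * z + x * z ^+ 2 + 4 *: y ^+ 3 + 2 *: (y ^+ 2 * z)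
  + 10 *: (y ^+ 2 * w) + 3 *: (y * z ^+ 2) + 8 *: (y * z * w)
  + 8 *: (y * w ^+ 2) + 8 *: z ^+ 3 + 7 *: (z ^+ 2 * w)
  + 7 *: (z * w ^+ 2) + 4 *: w ^+ 3.

Definition P8N1 : {mpoly 'F_11[4]} :=
  x ^+ 2 * y + x ^+ 2 * z + x * z ^+ 2 + 9 *: y ^+ 3 + 6 *: (y ^+ 2 * z)
  + 5 *: (y ^+ 2 * w) + 8 *: (y * z ^+ 2) + 5 *: (y * z * w)
  + 2 *: (y * w ^+ 2) + z ^+ 3 + 2 *: (z ^+ 2 * w)
  + 7 *: (z * w ^+ 2) + w ^+ 3.

End Curves.

Lemma coef_mx_QN1 :
  coef_mx QN1 = \matrix_(i, j) (if (i + j == 3)%N then 1 else 0).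
Proof.
have mnm_eq (a b i j : 'I_4) : (U_(a) + U_(b) == U_(i) + U_(j))%MM =
    ((a == i) && (b == j)) || ((a == j) && (b == i)).
  apply/eqP/orP => [E|[/andP[/eqP-> /eqP->]|/andP[/eqP-> /eqP->]]] //.
    have H k := congr1 (fun m : 'X_{1..4} => m k) E.
    move: (H 0) (H 1) (H 2) (H 3); rewrite !mnmDE !mnm1E {E H}.
    by case: a b i j => [[|[|[|[|//]]]] ?] [[|[|[|[|//]]]] ?]
                        [[|[|[|[|//]]]] ?] [[|[|[|[|//]]]] ?] //; auto.
  exact: addmC.
apply/matrixP => i j; rewrite !mxE /QN1 !mcoeffD !mcoeffZ -!mpolyXD !mcoeffX.
rewrite !mnm_eq.
by case: i j => [[|[|[|[|//]]]] ?] [[|[|[|[|//]]]] ?]; apply/eqP.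
Qed.

Lemma quad_form_QN1 : quad_form (coef_mx QN1) = QN1.
Proof. by rewrite coef_mx_QN1 quad_form_anti. Qed.

Canonical lin_aut_QN1_group P :=
  Group (lin_aut_group_set P quad_form_QN1).

(* Main.v *)
(* An automorphism is a similitude of the quadric, so its columns g0, g1, g2, g3
   are isotropic and g0, g3 and g1, g2 span orthogonal hyperbolic planes.  The
   lines (g0, g1) and (g0, g2) lie on the quadric, and P is multiplied by the
   factor r on all points of the quadric.  Once scalars are killed by
   normalizing g0, trying the F_11-points of the curve for g0, then g1 and g2 on
   the lines through it, and the unique possible g3, leaves a list of at most n
   matrices, n being the expected order: this is the upper bound.  For the lower
   bound, explicit automorphisms of the right orders are exhibited; they are
   certified by the polynomial identity g.P - r P = L Q.  The S_4 acts on the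
   projective space by permuting four points in general position. *)
From HB Require Import structures.
Require Import Defs.
From mathcomp Require Import all_boot all_algebra all_fingroup all_solvable.
From mathcomp Require Import boolp mpoly ring.

Set Implicit Arguments.
Unset Strict Implicit.
Unset Printing Implicit Defensive.

Import GRing.Theory.

(** * Recognition of cyclic, dihedral and Klein groups from element orders and an upper bound on the
    group order *)

Section GroupRecognition.
Local Open Scope group_scope.

Lemma isog_Zn (gT : finGroupType) (G : {group gT}) x n :
  (1 < n)%N -> x \in G -> #[x] = n -> (#|G| <= n)%N -> G \isog [set: 'Z_n].
Proof.
move=> n_gt1 Gx ox leG.
have -> : G = <[x]>%G.
  by apply/val_inj/esym/eqP; rewrite /= eqEcard cycle_subG Gx -orderE ox.
by have := Zp_isog x; rewrite ox /Zp n_gt1 isog_sym.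
Qed.

Section TwoInvolutions.
Variables (gT : finGroupType) (G : {group gT}) (x y : gT) (n : nat).
Hypotheses (Gx : x \in G) (Gy : y \in G) (ox : #[x] = 2) (oy : #[y] = 2).
Hypotheses (oxy : #[x * y] = n) (n_gt1 : (1 < n)%N) (leG : (#|G| <= n.*2)%N).

Let sub_G : <<[set x; y]>> \subset G.
Proof. by rewrite gen_subG subUset !sub1set Gx. Qed.

Let Hx : x \in <<[set x; y]>>. Proof. by rewrite mem_gen ?set21. Qed.
Let Hy : y \in <<[set x; y]>>. Proof. by rewrite mem_gen ?set22. Qed.

Let x_neq_y : x != y.
Proof.
apply: contraTneq n_gt1 => xy; suff -> : n = 1%N by [].
by rewrite -oxy -xy -[x * x]/(x ^+ 2) -{1}ox expg_order order1.
Qed.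

(* If x * y generated <<[set x; y]>>, this group would be cyclic of order n
   and contain two distinct involutions. *)
Lemma two_involutions_gen : <<[set x; y]>> = G /\ #|G| = n.*2.
Proof.
have sXY : <[x * y]> \subset <<[set x; y]>> by rewrite cycle_subG groupM.
(* The generated subgroup has order k n with 0 < k <= 2, so excluding k = 1 gives order 2 n, and the
   bound on [G] forces equality. *)
have: (n %| #|<<[set x; y]>>|)%N by rewrite -oxy cardSg.
case/dvdnP => k Hk.
have cardH_le : (#|<<[set x; y]>>| <= n.*2)%N := leq_trans (subset_leq_card sub_G) leG.
have k_le2 : (k <= 2)%N.
  by rewrite -(leq_pmul2r (ltnW n_gt1)) -Hk mul2n.
suff k_neq1 : k != 1%N.
  have k2 : k = 2.
    case: k Hk k_le2 k_neq1 => [|[|[|]]] // Hk; move: (cardG_gt0 <<[set x; y]>>).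
    by rewrite Hk.
  have eqG : <<[set x; y]>> = G.
    by apply/eqP; rewrite eqEcard sub_G Hk k2 mul2n.
  by split=> //; rewrite -eqG Hk k2 mul2n.
apply/eqP => k1; have defH : <[x * y]> = <<[set x; y]>>.
  by apply/eqP; rewrite eqEcard sXY Hk k1 mul1n -orderE oxy leqnn.
have sX : <[x]> \subset <[x * y]> by rewrite defH cycle_subG.
have sY : <[y]> \subset <[x * y]> by rewrite defH cycle_subG.
have /eqP cyc : <[x]> == <[y]>.
  by rewrite (eq_subG_cyclic (cycle_cyclic (x * y)) sX sY); apply/eqP/(etrans ox).
have: x \in <[y]> by rewrite -cyc cycle_id.
rewrite cycle2g // !inE => /orP[/eqP x1 | /eqP xy].
  by move: ox; rewrite x1 order1.
by have := x_neq_y; rewrite xy eqxx.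
Qed.

Lemma isog_dihedral : G \isog 'D_n.*2.
Proof.
have [defG cardG] := two_involutions_gen.
by have := involutions_gen_dihedral ox oy x_neq_y; rewrite /= defG cardG.
Qed.

(** When x y is also an involution, it equals its inverse y x; so x and y commute and generate an
    elementary abelian 2-group, determined up to isomorphism by its order 4. *)
Lemma isog_Klein : n = 2 -> G \isog setX [set: 'Z_2] [set: 'Z_2].
Proof.
move=> n2; have [defG cardG] := two_involutions_gen.
have sq1 z : #[z] = 2 -> z^-1 = z by move=> oz; rewrite invg_expg oz.
have cxy : commute x y.
  by rewrite /commute -[RHS]invgK invMg !sq1 // oxy.
have abG : 2.-abelem G.
  have cYX : <[y]> \subset 'C(<[x]>) by rewrite cent_cycle cycle_subG; apply/cent1P.
  have defXY : <[x]> \* <[y]> = G.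
    by rewrite cprodE // -cent_joinEr // joing_idl joing_idr.
  by rewrite (cprod_abelem _ defXY) !cycle_abelem ?orbT // ox oy.
rewrite (isog_abelem_card _ abG) cardG n2 cardsX !cardsT !card_ord andbT.
apply: exponent2_abelem; apply/exponentP => -[a b] _.
by case: a b => [[|[|//]] ?] [[|[|//]] ?]; apply/eqP.
Qed.
End TwoInvolutions.

End GroupRecognition.

(** * Computable arithmetic modulo 11, with encoded vectors, matrices and cubic forms *)

Local Open Scope ring_scope.

(* 'F_11 is unsuited to computations in the kernel; its elements are encoded as
   constructors, with tabulated operations. *)
Variant residue := R0 | R1 | R2 | R3 | R4 | R5 | R6 | R7 | R8 | R9 | R10.

Definition tabulate T (f : residue -> T) (a : residue) : T :=
  match a with
  | R0 => f R0 | R1 => f R1 | R2 => f R2 | R3 => f R3 | R4 => f R4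
  | R5 => f R5 | R6 => f R6 | R7 => f R7 | R8 => f R8 | R9 => f R9
  | R10 => f R10
  end.

Definition residues : seq residue :=
  [:: R0; R1; R2; R3; R4; R5; R6; R7; R8; R9; R10].

Definition nat_of_residue (a : residue) : nat :=
  match a with
  | R0 => 0 | R1 => 1 | R2 => 2 | R3 => 3 | R4 => 4 | R5 => 5
  | R6 => 6 | R7 => 7 | R8 => 8 | R9 => 9 | R10 => 10
  end.

Definition residue_of_nat (n : nat) : residue := nth R0 residues (n %% 11).

Definition radd : residue -> residue -> residue :=
  Eval compute in tabulate (fun a => tabulate (fun b =>
    residue_of_nat (nat_of_residue a + nat_of_residue b))).
Definition rmul : residue -> residue -> residue :=
  Eval compute in tabulate (fun a => tabulate (fun b =>
    residue_of_nat (nat_of_residue a * nat_of_residue b))).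
Definition ropp : residue -> residue :=
  Eval compute in tabulate (fun a => residue_of_nat (11 - nat_of_residue a)).
Definition req : residue -> residue -> bool :=
  Eval compute in tabulate (fun a => tabulate (fun b =>
    eqn (nat_of_residue a) (nat_of_residue b))).

Lemma reqP : Equality.axiom req.
Proof. by case; case; constructor. Qed.
HB.instance Definition _ := hasDecEq.Build residue reqP.

Definition rval (a : residue) : 'F_11 := (nat_of_residue a)%:R.
Definition rcode (a : 'F_11) : residue := residue_of_nat a.

Lemma rcodeK : cancel rcode rval.
Proof.
by case=> m lt_m; do 11?[case: m lt_m => [|m] lt_m; first exact/val_inj].
Qed.

Lemma rvalK : cancel rval rcode.
Proof. by case. Qed.

Lemma rval_inj : injective rval.
Proof. exact: can_inj rvalK. Qed.

Lemma rvalD a b : rval (radd a b) = rval a + rval b.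
Proof. by apply/eqP; case: a; case: b. Qed.

Lemma rvalM a b : rval (rmul a b) = rval a * rval b.
Proof. by apply/eqP; case: a; case: b. Qed.

Lemma rvalN a : rval (ropp a) = - rval a.
Proof. by apply/eqP; case: a. Qed.

Lemma rval0 : rval R0 = 0. Proof. by []. Qed.
Lemma rval1 : rval R1 = 1. Proof. by []. Qed.

Lemma rval_eq0 a : (rval a == 0) = (a == R0).
Proof. by rewrite -rval0 (inj_eq rval_inj). Qed.

Definition rvalE := (rvalD, rvalM, rvalN, rval0, rval1).

Lemma mem_residues a : a \in residues. Proof. by case: a. Qed.

(* A matrix is encoded as the tuple of its columns. *)
Definition vec := (residue * residue * residue * residue)%type.
Definition mat := (vec * vec * vec * vec)%type.

Definition proj4 T (v : T * T * T * T) (i : nat) : T :=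
  let: (a, b, c, d) := v in
  match i with 0 => a | 1 => b | 2 => c | _ => d end.

Definition make4 T (f : nat -> T) : T * T * T * T := (f 0, f 1, f 2, f 3).

Definition add4 (u v : vec) : vec := make4 (fun i => radd (proj4 u i) (proj4 v i)).
Definition scale4 (a : residue) (v : vec) : vec :=
  make4 (fun i => rmul a (proj4 v i)).
Definition unit4 (i : nat) : vec := make4 (fun j => if i == j then R1 else R0).

Definition mapply (M : mat) (v : vec) : vec :=
  add4 (add4 (scale4 (proj4 v 0) (proj4 M 0)) (scale4 (proj4 v 1) (proj4 M 1)))
       (add4 (scale4 (proj4 v 2) (proj4 M 2)) (scale4 (proj4 v 3) (proj4 M 3))).
Definition mmul (M N : mat) : mat := make4 (fun j => mapply M (proj4 N j)).
(** Polar form of the quadric, normalized so that [bilin v v] is the value of [QN1] at v. *)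
Definition bilin (u v : vec) : residue :=
  let: (a, b, c, d) := u in let: (a', b', c', d') := v in
  radd (radd (rmul a d') (rmul d a')) (radd (rmul b c') (rmul c b')).

(* A cubic form is encoded as the list of its terms: (c, (i, j, k)) stands for
   the term c x_i x_j x_k. *)
Definition cubic := seq (residue * (nat * nat * nat)).

Definition trilin (s : cubic) (u v w : vec) : residue :=
  foldr (fun t r => let: (c, (i, j, k)) := t in
           radd (rmul c (rmul (proj4 u i) (rmul (proj4 v j) (proj4 w k)))) r) R0 s.
Definition ceval (s : cubic) (v : vec) : residue := trilin s v v v.

Definition vecs : seq vec :=
  [seq (p.1.1, p.1.2, p.2.1, p.2.2) | p <- allpairs pair
     (allpairs pair residues residues) (allpairs pair residues residues)].

(** A projective point has exactly one representative whose first nonzero coordinate is 1; this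
    normalization kills the scalars. *)
Definition lead (v : vec) : residue :=
  let: (a, b, c, d) := v in
  if a == R0 then if b == R0 then if c == R0 then d else c else b else a.

(* The values at v, u + v and u - v determine the restriction of the cubic form
   to the line through u and v when the form vanishes at u. *)
Definition line_values s (u v : vec) : residue * residue * residue :=
  (ceval s v, ceval s (add4 u v), ceval s (add4 u (scale4 R10 v))).

(** * Exhaustive search for normalized automorphisms *)

Section Search.
Variables (s : cubic) (isotropic : seq vec).

(** The table [orth] pairs each isotropic vector orthogonal to g0 with its line values; it depends
    on g0 only and serves all factors r and both columns g1 and g2. *)
Definition column_candidates r (orth : seq (vec * (residue * residue * residue)))
    (i : nat) : seq vec :=
  let: (a, b, c) := line_values s (unit4 0) (unit4 i) in
  [seq p.1 | p <- orth & p.2 == (rmul r a, rmul r b, rmul r c)].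

Definition extensions (g0 : vec) : seq (residue * mat) :=
  let orth := [seq (v, line_values s g0 v) | v <- isotropic & bilin g0 v == R0] in
  flatten [seq
    flatten [seq
      flatten [seq
        [seq (r, (g0, g1, g2, g3)) | g3 <- isotropic
          & [&& bilin g1 g3 == R0, bilin g2 g3 == R0 & bilin g0 g3 == bilin g1 g2]]
      | g2 <- column_candidates r orth 2 & bilin g1 g2 != R0]
    | g1 <- column_candidates r orth 1]
  | r <- behead residues].

(** The last filter tests the factor r at the rational points of the quadric only. This is a
    necessary condition, which is what an upper bound requires. *)
Definition search_in : seq mat :=
  let points := [seq v <- isotropic | lead v == R1] in
  [seq p.2 | p <- flatten [seq extensions g0 | g0 <- points & ceval s g0 == R0]
     & all (fun v => ceval s (mapply p.2 v) == rmul p.1 (ceval s v)) points].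
End Search.

Definition search (s : cubic) : seq mat :=
  search_in s [seq v <- vecs | bilin v v == R0].

Definition C1 : cubic :=
  [:: (R1, (0, 0, 1)); (R1, (0, 0, 2)); (R2, (1, 1, 2)); (R5, (1, 1, 3));
      (R9, (1, 2, 2)); (R1, (1, 2, 3)); (R4, (2, 2, 2)); (R3, (2, 2, 3));
      (R10, (2, 3, 3)); (R1, (3, 3, 3))]%N.
Definition C2 : cubic :=
  [:: (R1, (0, 0, 1)); (R1, (0, 0, 2)); (R1, (1, 1, 1)); (R1, (1, 1, 2));
      (R7, (1, 2, 2)); (R4, (1, 3, 3)); (R2, (2, 2, 2)); (R9, (2, 3, 3))]%N.
Definition C3 : cubic :=
  [:: (R1, (0, 0, 1)); (R1, (0, 0, 2)); (R1, (1, 1, 1)); (R8, (1, 1, 2));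
      (R3, (1, 2, 2)); (R10, (1, 3, 3)); (R10, (2, 2, 2)); (R10, (2, 3, 3))]%N.
Definition C4 : cubic :=
  [:: (R1, (0, 0, 1)); (R1, (0, 0, 2)); (R1, (1, 1, 1)); (R9, (1, 1, 2));
      (R2, (1, 1, 3)); (R3, (1, 2, 2)); (R3, (1, 2, 3)); (R4, (1, 3, 3));
      (R10, (2, 2, 2)); (R2, (2, 2, 3)); (R6, (2, 3, 3))]%N.
Definition C5 : cubic :=
  [:: (R1, (0, 0, 1)); (R1, (0, 0, 2)); (R1, (0, 2, 2)); (R10, (1, 1, 3));
      (R9, (1, 2, 2)); (R9, (1, 3, 3)); (R8, (2, 2, 2)); (R8, (2, 2, 3));
      (R8, (2, 3, 3)); (R3, (3, 3, 3))]%N.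
Definition C6 : cubic :=
  [:: (R1, (0, 0, 1)); (R1, (0, 0, 2)); (R1, (0, 2, 2)); (R9, (1, 1, 2));
      (R5, (1, 1, 3)); (R1, (1, 2, 3)); (R8, (1, 3, 3)); (R3, (2, 2, 2));
      (R9, (2, 2, 3)); (R2, (2, 3, 3)); (R5, (3, 3, 3))]%N.
Definition C7 : cubic :=
  [:: (R1, (0, 0, 1)); (R1, (0, 0, 2)); (R1, (0, 2, 2)); (R4, (1, 1, 1));
      (R2, (1, 1, 2)); (R10, (1, 1, 3)); (R3, (1, 2, 2)); (R8, (1, 2, 3));
      (R8, (1, 3, 3)); (R8, (2, 2, 2)); (R7, (2, 2, 3)); (R7, (2, 3, 3));
      (R4, (3, 3, 3))]%N.
Definition C8 : cubic :=
  [:: (R1, (0, 0, 1)); (R1, (0, 0, 2)); (R1, (0, 2, 2)); (R9, (1, 1, 1));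
      (R6, (1, 1, 2)); (R5, (1, 1, 3)); (R8, (1, 2, 2)); (R5, (1, 2, 3));
      (R2, (1, 3, 3)); (R1, (2, 2, 2)); (R2, (2, 2, 3)); (R7, (2, 3, 3));
      (R1, (3, 3, 3))]%N.

(** * Translation of the encodings into matrices and polynomials *)

Lemma proj4_make4 T (f : nat -> T) (i : nat) : (i < 4)%N -> proj4 (make4 f) i = f i.
Proof. by case: i => [|[|[|[|i]]]]. Qed.

Lemma eq_proj4 T (u v : T * T * T * T) :
  (forall i : nat, (i < 4)%N -> proj4 u i = proj4 v i) -> u = v.
Proof.
case: u v => [[[a b] c] d] [[[a' b'] c'] d'] uv.
by congr (_, _, _, _); [apply: (uv 0) | apply: (uv 1) | apply: (uv 2) | apply: (uv 3)].
Qed.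

Definition mx_of (M : mat) : 'M['F_11]_4 :=
  \matrix_(i, j) rval (proj4 (proj4 M j) i).
Definition mx_code (A : 'M['F_11]_4) : mat :=
  make4 (fun j => make4 (fun i => rcode (A (inord i) (inord j)))).

Lemma mx_codeK : cancel mx_code mx_of.
Proof.
by move=> A; apply/matrixP => i j; rewrite mxE !proj4_make4 // rcodeK !inord_val.
Qed.

Lemma mx_of_inj : injective mx_of.
Proof.
move=> M N /matrixP MN; apply: eq_proj4 => j lt_j; apply: eq_proj4 => i lt_i.
by have := MN (Ordinal lt_i) (Ordinal lt_j); rewrite !mxE => /rval_inj.
Qed.

Lemma sum4 (V : nmodType) (f : 'I_4 -> V) :
  \sum_i f i = f (inord 0) + f (inord 1) + f (inord 2) + f (inord 3).
Proof.
rewrite !big_ord_recr big_ord0 /= add0r.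
by congr (f _ + f _ + f _ + f _); apply/val_inj; rewrite /= inordK.
Qed.

Definition vec_of (v : vec) (i : 'I_4) : 'F_11 := rval (proj4 v i).

Lemma vec_ofD u v i : vec_of (add4 u v) i = vec_of u i + vec_of v i.
Proof. by rewrite /vec_of /add4 proj4_make4 // rvalD. Qed.

Lemma vec_ofZ c v i : vec_of (scale4 c v) i = rval c * vec_of v i.
Proof. by rewrite /vec_of /scale4 proj4_make4 // rvalM. Qed.

Lemma vec_of_mapply M v i :
  vec_of (mapply M v) i = \sum_j mx_of M i j * vec_of v j.
Proof.
rewrite /mapply !vec_ofD !vec_ofZ sum4 !mxE /vec_of !inordK // -!addrA.
by congr (_ + (_ + (_ + _))); rewrite mulrC.
Qed.

Lemma mx_ofM M N : mx_of (mmul M N) = mx_of M *m mx_of N.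
Proof.
apply/matrixP => i j; rewrite !mxE /mmul proj4_make4 //.
by rewrite -/(vec_of _ i) vec_of_mapply; apply: eq_bigr => k _; rewrite !mxE.
Qed.

Definition bilin_mx : 'M['F_11]_4 :=
  \matrix_(i, j) (if (i + j == 3)%N then 1 else 0).

Lemma bilin_mxM : bilin_mx *m bilin_mx = 1%:M.
Proof.
apply/matrixP => i j; rewrite mxE (bigD1 (rev_ord i)) //= !mxE big1 => [|k].
  by case: i j => [[|[|[|[|//]]]] ?] [[|[|[|[|//]]]] ?]; apply/eqP.
by rewrite !mxE; case: i j k => [[|[|[|[|//]]]] ?] [[|[|[|[|//]]]] ?]
  [[|[|[|[|//]]]] ?]; rewrite ?mul0r ?mulr0.
Qed.

Lemma rval_bilin u v : rval (bilin u v) =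
  \sum_i \sum_j vec_of u i * bilin_mx i j * vec_of v j.
Proof.
case: u v => [[[a b] c] d] [[[a' b'] c'] d'].
rewrite !sum4 /vec_of !mxE !inordK //= !rvalE.
by ring.
Qed.

(** The Gram matrix of the columns turns the matrix identity of a similitude into conditions on
    pairs of columns. *)
Lemma bilin_col M i j : (i < 4)%N -> (j < 4)%N ->
  rval (bilin (proj4 M i) (proj4 M j)) =
  ((mx_of M)^T *m bilin_mx *m mx_of M) (inord i) (inord j).
Proof.
move=> lt_i lt_j; rewrite rval_bilin exchange_big mxE; apply: eq_bigr => l _.
rewrite mxE mulr_suml; apply: eq_bigr => k _.
by rewrite !mxE /vec_of !inordK.
Qed.

(** Clamping at 3 agrees with the default branch of [proj4], so [proj4_idx] holds for every natural
    index and cubic lists need no bound on their indices. *)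
Definition idx (i : nat) : 'I_4 := inord (minn i 3).

Lemma proj4_idx T (v : T * T * T * T) i : proj4 v (idx i) = proj4 v i.
Proof. by case: i v => [|[|[|i]]] [[[? ?] ?] ?]; rewrite inordK. Qed.

Definition term_mpoly (t : residue * (nat * nat * nat)) : {mpoly 'F_11[4]} :=
  let: (c, (i, j, k)) := t in rval c *: ('X_(idx i) * 'X_(idx j) * 'X_(idx k)).
Definition cubic_mpoly (s : cubic) : {mpoly 'F_11[4]} :=
  \sum_(t <- s) term_mpoly t.

Lemma meval_cubic s v : (cubic_mpoly s).@[vec_of v] = rval (ceval s v).
Proof.
rewrite /cubic_mpoly /ceval /trilin; elim: s => [|[c [[i j] k]] s IHs] /=.
  by rewrite big_nil meval0.
rewrite big_cons mevalD IHs /= mevalZ !mevalM !mevalXU /vec_of !proj4_idx !rvalE.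
by rewrite !mulrA.
Qed.

Lemma meval_QN1 v : QN1.@[vec_of v] = rval (bilin v v).
Proof.
rewrite /QN1 mevalD !mevalZ !mevalM !mevalXU /vec_of.
by case: v => [[[a b] c] d]; rewrite /= !rvalE; ring.
Qed.

Lemma meval_mx_subst M (P : {mpoly 'F_11[4]}) v :
  (mx_subst (mx_of M) P).@[vec_of v] = P.@[vec_of (mapply M v)].
Proof.
rewrite /mx_subst comp_mpoly_meval; apply: meval_eq => i.
rewrite tnth_mktuple raddf_sum vec_of_mapply /=; apply: eq_bigr => k _.
by rewrite mevalZ mevalXU.
Qed.

(** * Enumeration of the automorphisms *)

(** The trace that an automorphism leaves on rational points: the congruence modulo Q is weakened to
    an equality of values at isotropic vectors, which can be tested by computation. *)
Definition similitude s M mu r :=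
  [/\ mu != R0, r != R0,
      forall i j : nat, (i < 4)%N -> (j < 4)%N ->
        bilin (proj4 M i) (proj4 M j) = if (i + j == 3)%N then mu else R0 &
      forall v, bilin v v = R0 -> ceval s (mapply M v) = rmul r (ceval s v)].

(** Evaluating g.P - r P = L Q at a zero of Q kills the right-hand side. *)
Lemma lin_aut_similitude s (g : {'GL_4['F_11]}) :
  g \in lin_aut QN1 (cubic_mpoly s) ->
  exists mu r, similitude s (mx_code (GLval g)) mu r.
Proof.
rewrite inE => /asboolP[[mu mu0 phi_g] [r r0 [L P_g]]].
exists (rcode mu), (rcode r).
split; rewrite -?rval_eq0 ?rcodeK //.
  move=> i j lt_i lt_j; apply: rval_inj; rewrite bilin_col // mx_codeK.
  move: phi_g; rewrite coef_mx_QN1 -/bilin_mx => ->; rewrite !mxE !inordK //.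
  by case: ifP; rewrite ?mulr1 ?mulr0 ?rcodeK.
move=> v v0; apply: rval_inj; rewrite rvalM rcodeK -!meval_cubic -meval_mx_subst mx_codeK.
apply/eqP; rewrite -subr_eq0 -mevalZ -mevalB P_g mevalM meval_QN1 v0.
by rewrite mulr0.
Qed.

Lemma bilinZ c d u v :
  bilin (scale4 c u) (scale4 d v) = rmul (rmul c d) (bilin u v).
Proof.
case: u v => [[[x y] z] w] [[[x' y'] z'] w'].
by apply: rval_inj; rewrite /= !rvalE; ring.
Qed.

Lemma trilin_cons c i j k s u v w : trilin ((c, (i, j, k)) :: s) u v w =
  radd (rmul c (rmul (proj4 u i) (rmul (proj4 v j) (proj4 w k)))) (trilin s u v w).
Proof. by []. Qed.

Lemma trilinZ s c u v w :
  trilin s (scale4 c u) (scale4 c v) (scale4 c w) =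
  rmul (rmul c (rmul c c)) (trilin s u v w).
Proof.
have proj4Z (x : vec) i : proj4 (scale4 c x) i = rmul c (proj4 x i).
  by case: i => [|[|[|i]]].
apply: rval_inj; elim: s => [|[a [[i j] k]] s IHs].
  by rewrite !rvalE mulr0.
by move: IHs; rewrite !trilin_cons !proj4Z !rvalE => ->; ring.
Qed.

Definition mscale c (M : mat) : mat := make4 (fun j => scale4 c (proj4 M j)).

Lemma mx_of_scale c M : mx_of (mscale c M) = rval c *: mx_of M.
Proof. by apply/matrixP => i j; rewrite !mxE !proj4_make4 // rvalM. Qed.

Lemma vec_of_inj u v : vec_of u =1 vec_of v -> u = v.
Proof.
by move=> uv; apply: eq_proj4 => i lt_i; apply: rval_inj (uv (Ordinal lt_i)).
Qed.

Lemma mapply_scale c M v : mapply (mscale c M) v = scale4 c (mapply M v).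
Proof.
apply: vec_of_inj => i; rewrite vec_of_mapply mx_of_scale.
rewrite vec_ofZ vec_of_mapply mulr_sumr.
by apply: eq_bigr => j _; rewrite mxE mulrA.
Qed.

Lemma rmul0r a : rmul R0 a = R0. Proof. by case: a. Qed.

Lemma rmul_neq0 a b : a != R0 -> b != R0 -> rmul a b != R0.
Proof. by case: a; case: b. Qed.

(** Allows the first column to be normalized; the factors change by the degrees 2 and 3 of the
    forms. *)
Lemma similitude_scale s M mu r c : c != R0 -> similitude s M mu r ->
  similitude s (mscale c M) (rmul (rmul c c) mu) (rmul (rmul c (rmul c c)) r).
Proof.
move=> c0 [mu0 r0 bM cM]; split; rewrite ?rmul_neq0 //.
  move=> i j lt_i lt_j; rewrite !proj4_make4 // bilinZ bM //; case: ifP => // _.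
  by apply: rval_inj; rewrite rvalM mulr0.
move=> v v0; rewrite mapply_scale /ceval trilinZ -/(ceval _ _) cM //.
by apply: rval_inj; rewrite !rvalM !mulrA.
Qed.

Lemma mem_vecs v : v \in vecs.
Proof.
case: v => [[[a b] c] d]; apply/mapP; exists ((a, b), (c, d)) => //.
by do !apply: allpairs_f; rewrite mem_residues.
Qed.

Lemma mapply_unit4 M i : (i < 4)%N -> mapply M (unit4 i) = proj4 M i.
Proof.
move=> lt_i; apply: vec_of_inj => k; rewrite vec_of_mapply.
rewrite (bigD1 (Ordinal lt_i)) // big1 => [|j ji].
  by rewrite /vec_of /unit4 proj4_make4 // eqxx rval1 mulr1 mxE /= addr0.
rewrite /vec_of /unit4 proj4_make4 // ifN ?mulr0 //.
by apply: contraNneq ji => ij; apply/eqP/val_inj.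
Qed.

Lemma mapplyD M u v : mapply M (add4 u v) = add4 (mapply M u) (mapply M v).
Proof.
apply: vec_of_inj => k; rewrite vec_ofD !vec_of_mapply -big_split.
by apply: eq_bigr => j _; rewrite vec_ofD mulrDr.
Qed.

Lemma mapplyZ M c v : mapply M (scale4 c v) = scale4 c (mapply M v).
Proof.
apply: vec_of_inj => k; rewrite vec_ofZ !vec_of_mapply mulr_sumr.
by apply: eq_bigr => j _; rewrite vec_ofZ mulrCA.
Qed.

(** Column i is the image of the i-th unit vector e_i. As e_0 lies on the curve, so does column 0,
    and every filter of the search is a necessary condition on these images. *)
Lemma search_complete s M mu r : ceval s (unit4 0) = R0 ->
  similitude s M mu r -> lead (proj4 M 0) = R1 -> M \in search s.
Proof.
move=> s0 [mu0 r0 bM cM] M1; rewrite /search.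
set iso := [seq v <- vecs | _].
have isoM i : (i < 4)%N -> proj4 M i \in iso.
  by move=> lt_i; rewrite mem_filter mem_vecs andbT bM //; case: i lt_i => [|[|[|[|]]]].
have iso0 v : v \in iso -> bilin v v = R0.
  by rewrite mem_filter => /andP[/eqP].
(* The list becomes abstract: only these two properties are used, and the 11^4 vectors are not
   unfolded. *)
move: iso isoM iso0 => iso isoM iso0.
have ceM i : (i < 4)%N -> ceval s (proj4 M i) = rmul r (ceval s (unit4 i)).
  move=> lt_i; rewrite -mapply_unit4 // cM //.
  by case: i lt_i => [|[|[|[|]]]].
(* For i = 1, 2 the vectors e_i, e_0 + e_i and e_0 - e_i are all isotropic, so [cM] applies to each
   of them; for i = 3 this would fail. *)
have linesM i : i \in [:: 1; 2]%N ->
    line_values s (proj4 M 0) (proj4 M i) =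
    (let: (a, b, c) := line_values s (unit4 0) (unit4 i) in
     (rmul r a, rmul r b, rmul r c)).
  move=> i12; have lt_i : (i < 4)%N by case: i i12 => [|[|[|]]].
  rewrite /line_values ceM // -!mapply_unit4 // -mapplyZ -!mapplyD.
  by rewrite !cM //; case: i i12 {lt_i} => [|[|[|i]]].
have candM i : i \in [:: 1; 2]%N -> proj4 M i \in column_candidates s r
    [seq (v, line_values s (proj4 M 0) v) | v <- iso & bilin (proj4 M 0) v == R0] i.
  move=> i12; have := linesM i i12; rewrite /column_candidates.
  case: (line_values s (unit4 0) (unit4 i)) => [[a b] c] lM.
  apply/mapP; exists (proj4 M i, line_values s (proj4 M 0) (proj4 M i)) => //.
  rewrite mem_filter; apply/andP; split; first by rewrite /= lM.
  apply: (map_f (fun v => (v, line_values s (proj4 M 0) v))).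
  rewrite mem_filter bM ?isoM //; by case: i i12 {lM} => [|[|[|i]]].
apply/mapP; exists (r, M) => //; rewrite mem_filter; apply/andP; split.
  by apply/allP => v; rewrite mem_filter => /andP[_ /iso0 v0] /=; rewrite cM.
apply/flatten_mapP; exists (proj4 M 0).
  by rewrite !mem_filter M1 isoM // ceM // s0 !andbT; case: (r).
apply/flatten_mapP; exists r; first by case: (r) r0.
apply/flatten_mapP; exists (proj4 M 1); first exact: candM.
apply/flatten_mapP; exists (proj4 M 2).
  by rewrite mem_filter candM // bM //= mu0.
apply/mapP; exists (proj4 M 3); last by case: (M) => [[[]]].
by rewrite mem_filter !bM //= !eqxx isoM.
Qed.

Lemma leadZ c v : c != R0 -> lead (scale4 c v) = rmul c (lead v).
Proof.
move=> c0; have rmul_eq0 a : (rmul c a == R0) = (a == R0) by case: c c0; case: a.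
by case: v => [[[x y] z] w]; rewrite /= !rmul_eq0; do !case: ifP.
Qed.

(** Column 0 pairs with column 3 to the nonzero value mu, so it is not the zero vector. *)
Lemma lead_neq0 s M mu r : similitude s M mu r -> lead (proj4 M 0) != R0.
Proof.
case=> mu0 _ bM _; apply: contraNneq mu0.
have <- : bilin (proj4 M 0) (proj4 M 3) = mu by rewrite bM.
case: (proj4 M 0) (proj4 M 3) => [[[x y] z] w] [[[x' y'] z'] w'] /=.
case: eqP => [-> | /eqP/negPf x0 /eqP]; last by rewrite x0.
case: eqP => [-> | /eqP/negPf y0 /eqP]; last by rewrite y0.
case: eqP => [-> -> | /eqP/negPf z0 /eqP]; last by rewrite z0.
by rewrite !rmul0r.
Qed.

(** Singular matrices are sent to the identity, hence the invertibility hypotheses below. *)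
Definition GLof (A : 'M['F_11]_4) : {'GL_4['F_11]} := insubd (1%g : {'GL_4['F_11]}) A.

Lemma GLof_val A : A \in unitmx -> GLval (GLof A) = A.
Proof. by move=> uA; rewrite /GLof /insubd insubT. Qed.

Lemma norm_scalars_mem (g : {'GL_4['F_11]}) : g \in ('N(@scalars 'F_11))%g.
Proof. by apply: (subsetP (norm_scalars [set: _])); rewrite inE. Qed.

Definition cls (M : mat) : coset_of (@scalars 'F_11) :=
  coset (@scalars 'F_11) (GLof (mx_of M)).

Lemma coset_scale (g h : {'GL_4['F_11]}) (c : 'F_11) :
  GLval g = c *: GLval h -> coset (@scalars 'F_11) g = coset (@scalars 'F_11) h.
Proof.
move=> gh; apply/rcoset_kercosetP; rewrite ?norm_scalars_mem //.
apply/rcosetP; exists (g * h^-1)%g.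
  rewrite inE; apply/is_scalar_mxP; exists c; rewrite GL_MxE gh.
  by rewrite -scalemxAl mulmxV ?scalemx1 //; apply: GL_unit.
by rewrite mulgKV.
Qed.

(** Every class modulo scalars has a representative whose first column has leading coordinate 1, and
    the search finds it. *)
Lemma card_curve_aut s : ceval s (unit4 0) = R0 ->
  (#|curve_aut QN1 (cubic_mpoly s)| <= size (search s))%N.
Proof.
move=> s0; rewrite -(size_map cls); apply: leq_trans (card_size _).
apply/subset_leq_card/subsetP => _ /morphimP[g _ g_aut ->].
have [mu [r simM]] := lin_aut_similitude g_aut.
set M := mx_code _ in simM; set c := proj4 M 0.
have [d dc] : exists d, rmul d (lead c) = R1.
  have := lead_neq0 simM; rewrite -/c; case: (lead c) => // _.
  (* The inverses of 1, ..., 10 modulo 11. *)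
  - by exists R1.
  - by exists R6.
  - by exists R4.
  - by exists R3.
  - by exists R9.
  - by exists R2.
  - by exists R8.
  - by exists R7.
  - by exists R5.
  - by exists R10.
have d0 : d != R0 by apply: contra_eq_neq dc => ->; case: (lead c).
apply/mapP; exists (mscale d M).
  apply: search_complete s0 (similitude_scale d0 simM) _.
  by rewrite proj4_make4 // leadZ.
have dg : mx_of (mscale d M) = rval d *: GLval g by rewrite mx_of_scale mx_codeK.
symmetry; apply: (@coset_scale _ _ (rval d)); rewrite GLof_val dg //.
rewrite unitmxZ ?unitfE ?rval_eq0 //.
exact: (GL_unit g).
Qed.

(** * Certified automorphisms *)

(** The tensor t need not be symmetric: a monomial collects the entries at all orderings of its
    indices, so distinct tensors may give the same form. *)
Definition cubic_form (t : 'I_4 -> 'I_4 -> 'I_4 -> 'F_11) : {mpoly 'F_11[4]} :=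
  \sum_a \sum_b \sum_c t a b c *: ('X_a * 'X_b * 'X_c).

Lemma cubic_formB t u :
  cubic_form t - cubic_form u = cubic_form (fun a b c => t a b c - u a b c).
Proof.
rewrite /cubic_form -sumrB; apply: eq_bigr => a _.
rewrite -sumrB; apply: eq_bigr => b _; rewrite -sumrB; apply: eq_bigr => c _.
by rewrite scalerBl.
Qed.

Lemma cubic_formZ r t :
  r *: cubic_form t = cubic_form (fun a b c => r * t a b c).
Proof.
rewrite /cubic_form scaler_sumr; apply: eq_bigr => a _.
rewrite scaler_sumr; apply: eq_bigr => b _; rewrite scaler_sumr.
by apply: eq_bigr => c _; rewrite scalerA.
Qed.

(* Summing over the six permutations of the indices multiplies the form by 6,
   which is invertible modulo 11. *)
Lemma cubic_form_eq0 t :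
  (forall a b c : 'I_4, t a b c + t a c b + t b a c + t b c a + t c a b + t c b a = 0) ->
  cubic_form t = 0.
Proof.
move=> t0; have swap12 u : cubic_form u = cubic_form (fun a b c => u b a c).
  rewrite /cubic_form exchange_big; apply: eq_bigr => b _; apply: eq_bigr => a _.
  by apply: eq_bigr => c _; rewrite ['X_a * _]mulrC.
have swap23 u : cubic_form u = cubic_form (fun a b c => u a c b).
  rewrite /cubic_form; apply: eq_bigr => a _; rewrite exchange_big.
  by apply: eq_bigr => c _; apply: eq_bigr => b _; rewrite mulrAC.
have D u v : cubic_form u + cubic_form v = cubic_form (fun a b c => u a b c + v a b c).
  rewrite /cubic_form -big_split; apply: eq_bigr => a _ /=.
  rewrite -big_split; apply: eq_bigr => b _ /=; rewrite -big_split.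
  by apply: eq_bigr => c _ /=; rewrite scalerDl.
have: 6%:R *: cubic_form t = 0.
  transitivity (cubic_form (fun a b c =>
      t a b c + t a c b + t b a c + t b c a + t c a b + t c b a)).
    (* Each of the last five summands is carried back to [cubic_form t] by adjacent transpositions
       that sort its indices. *)
    rewrite -!D [X in _ + X + _ + _ + _ + _]swap23 [X in _ + X + _ + _ + _]swap12.
    rewrite [X in _ + X + _ + _]swap12 [X in _ + X + _ + _]swap23.
    rewrite [X in _ + X + _]swap23 [X in _ + X + _]swap12.
    rewrite [X in _ + X]swap12 [X in _ + X]swap23 [X in _ + X]swap12.
    by rewrite scaler_nat !mulrS mulr0n addr0 !addrA.
  rewrite /cubic_form big1 // => a _; rewrite big1 // => b _; rewrite big1 // => c _.
  by rewrite t0 scale0r.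
by move/eqP; rewrite scaler_eq0 => /orP[|/eqP].
Qed.

Definition id_mat : mat := make4 unit4.

Lemma mx_of_id : mx_of id_mat = 1%:M.
Proof.
apply/matrixP => i j; rewrite !mxE /id_mat proj4_make4 // /unit4 proj4_make4 //.
by rewrite eq_sym -val_eqE; case: ifP.
Qed.

(** By multilinearity: the coefficients of X_a in the four linear forms that are substituted make up
    column a of the matrix. *)
Lemma mx_subst_cubic M s :
  mx_subst (mx_of M) (cubic_mpoly s) =
  cubic_form (fun a b c => rval (trilin s (proj4 M a) (proj4 M b) (proj4 M c))).
Proof.
elim: s => [|[c [[i j] k]] s IHs].
  rewrite /cubic_mpoly big_nil /mx_subst comp_mpoly0 /cubic_form big1 // => a _.
  by rewrite big1 // => b _; rewrite big1 // => e _; rewrite scale0r.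
rewrite /cubic_mpoly big_cons -/(cubic_mpoly s) /mx_subst comp_mpolyD.
rewrite -/(mx_subst _ _) -/(mx_subst _ (cubic_mpoly s)) IHs /mx_subst /=.
rewrite comp_mpolyZ !rmorphM /= !comp_mpolyXU -!tnth_nth !tnth_mktuple.
rewrite /cubic_form !mulr_suml scaler_sumr -big_split; apply: eq_bigr => a _ /=.
rewrite -mulrA mulr_suml mulr_sumr scaler_sumr -big_split; apply: eq_bigr => b _ /=.
rewrite !mulr_sumr scaler_sumr -big_split; apply: eq_bigr => d _ /=.
rewrite -/(trilin s _ _ _) !rvalE scalerDl; congr (_ + _).
rewrite !mxE !proj4_idx -!scalerAl -!scalerAr !scalerA mulrA.
by rewrite -!mulrA.
Qed.

Lemma cubic_mpoly_form s : cubic_mpoly s =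
  cubic_form (fun a b c => rval (trilin s (unit4 a) (unit4 b) (unit4 c))).
Proof.
rewrite -[LHS]mx_subst1 -mx_of_id mx_subst_cubic /cubic_form.
apply: eq_bigr => a _; apply: eq_bigr => b _; apply: eq_bigr => c _.
by rewrite /id_mat !proj4_make4.
Qed.

Definition linear_form (l : vec) : {mpoly 'F_11[4]} := \sum_a vec_of l a *: 'X_a.

Lemma linear_formM l : linear_form l * QN1 =
  cubic_form (fun a b c => rval (rmul (proj4 l a) (bilin (unit4 b) (unit4 c)))).
Proof.
have bil (b c : 'I_4) : rval (bilin (unit4 b) (unit4 c)) = bilin_mx b c.
  have := @bilin_col id_mat b c (ltn_ord b) (ltn_ord c).
  by rewrite /id_mat !proj4_make4 // mx_of_id trmx1 mul1mx mulmx1 !inord_val.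
rewrite -quad_form_QN1 coef_mx_QN1 -/bilin_mx /quad_form mulr_suml.
apply: eq_bigr => a _; rewrite mulr_sumr; apply: eq_bigr => b _.
rewrite mulr_sumr; apply: eq_bigr => c _.
by rewrite rvalM bil -scalerAl -scalerAr scalerA mulrA.
Qed.

Definition symmetrized (t : nat -> nat -> nat -> residue) a b c :=
  radd (radd (radd (radd (radd (t a b c) (t a c b)) (t b a c)) (t b c a)) (t c a b))
       (t c b a).

Definition similar_bilin (M : mat) : bool :=
  let mu := bilin (proj4 M 0) (proj4 M 3) in
  (mu != R0) && all (fun i => all (fun j =>
    bilin (proj4 M i) (proj4 M j) == if (i + j == 3)%N then mu else R0)
    (iota 0 4)) (iota 0 4).

(* The certificate l lists the coefficients of the linear form L such that
   g.P - r P = L Q.  Two cubic forms are equal when the symmetrizations of their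
   tensors of coefficients are. *)
Definition certifies s (M : mat) r l : bool :=
  let t a b c :=
    radd (radd (trilin s (proj4 M a) (proj4 M b) (proj4 M c))
               (ropp (rmul r (trilin s (unit4 a) (unit4 b) (unit4 c)))))
         (ropp (rmul (proj4 l a) (bilin (unit4 b) (unit4 c)))) in
  [&& similar_bilin M, r != R0 &
      all (fun a => all (fun b => all (fun c => symmetrized t a b c == R0)
        (iota 0 4)) (iota 0 4)) (iota 0 4)].

Lemma all_iotaP n (p : pred nat) :
  reflect (forall i, (i < n)%N -> p i) (all p (iota 0 n)).
Proof.
by apply: (iffP allP) => pn i; [move=> lt_i; apply: pn; rewrite mem_iota
  | rewrite mem_iota => /pn].
Qed.

Lemma similar_bilinP M : similar_bilin M -> exists2 mu : 'F_11, mu != 0 &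
  (mx_of M)^T *m bilin_mx *m mx_of M = mu *: bilin_mx.
Proof.
rewrite /similar_bilin; set mu := bilin _ _ => /andP[mu0 /all_iotaP bM].
exists (rval mu); first by rewrite rval_eq0.
apply/matrixP => i j; rewrite -{1}(inord_val i) -{1}(inord_val j) -bilin_col //.
have /all_iotaP/(_ j (ltn_ord j))/eqP-> := bM i (ltn_ord i).
by rewrite !mxE; case: ifP; rewrite ?mulr1 ?mulr0.
Qed.

(** Since the Gram matrix squares to 1, the similitude identity exhibits a left inverse. *)
Lemma similar_bilin_unit M : similar_bilin M -> mx_of M \in unitmx.
Proof.
case/similar_bilinP => mu mu0 bM.
suff: (mu^-1 *: (bilin_mx *m (mx_of M)^T *m bilin_mx)) *m mx_of M = 1%:M.
  by case/mulmx1_unit.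
by rewrite -scalemxAl -!mulmxA (mulmxA _ bilin_mx) bM -scalemxAr bilin_mxM
  scalerA mulVf ?scale1r.
Qed.

Lemma lin_aut_certified s M r l :
  certifies s M r l -> GLof (mx_of M) \in lin_aut QN1 (cubic_mpoly s).
Proof.
case/and3P => bM r0 /all_iotaP tM; rewrite inE; apply/asboolP.
rewrite /preserves_curve GLof_val ?similar_bilin_unit //; split.
  by rewrite coef_mx_QN1; apply: similar_bilinP.
exists (rval r); first by rewrite rval_eq0.
exists (linear_form l); apply/eqP; rewrite -subr_eq0; apply/eqP.
rewrite mx_subst_cubic cubic_mpoly_form linear_formM cubic_formZ !cubic_formB.
apply: cubic_form_eq0 => a b c.
have /all_iotaP/(_ b (ltn_ord b))/all_iotaP/(_ c (ltn_ord c))/eqP := tM a (ltn_ord a).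
by rewrite /symmetrized => /(congr1 rval); rewrite !rvalE.
Qed.

Lemma cls_aut s M r l : certifies s M r l -> cls M \in curve_aut QN1 (cubic_mpoly s).
Proof. by move=> /lin_aut_certified; apply: mem_quotient. Qed.

Lemma coset_scalarsM (g h : {'GL_4['F_11]}) :
  coset (@scalars 'F_11) (g * h) =
  (coset (@scalars 'F_11) g * coset (@scalars 'F_11) h)%g.
Proof. exact: coset_morphM (norm_scalars_mem g) (norm_scalars_mem h). Qed.

Lemma GLofM A B : A \in unitmx -> B \in unitmx ->
  GLof (A *m B) = (GLof A * GLof B)%g.
Proof.
move=> uA uB; have uAB : A *m B \in unitmx by rewrite unitmx_mul uA.
apply/val_inj; rewrite -[LHS]/(GLval _) -[RHS]/(GLval _ *m GLval _).
by rewrite (GLof_val uAB) (GLof_val uA) (GLof_val uB).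
Qed.

Lemma clsM M N : mx_of M \in unitmx -> mx_of N \in unitmx ->
  cls (mmul M N) = (cls M * cls N)%g.
Proof.
by move=> uM uN; rewrite /cls mx_ofM (GLofM uM uN) coset_scalarsM.
Qed.

Definition scalar_mat (M : mat) : bool :=
  M == mscale (proj4 (proj4 M 0) 0) id_mat.

Lemma coset_scalar_eq1 (g : {'GL_4['F_11]}) :
  (coset (@scalars 'F_11) g == 1%g) = is_scalar_mx (GLval g).
Proof.
apply/eqP/idP => [/(coset_idr (norm_scalars_mem g))|g1]; first by rewrite inE.
by apply: coset_id; rewrite inE.
Qed.

Lemma cls_eq1 M : mx_of M \in unitmx -> (cls M == 1%g) = scalar_mat M.
Proof.
move=> uM; rewrite coset_scalar_eq1 GLof_val //.
apply/is_scalar_mxP/eqP => [[a Ma]|->]; last first.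
  by exists (rval (proj4 (proj4 M 0) 0)); rewrite mx_of_scale mx_of_id scalemx1.
apply: mx_of_inj; rewrite mx_of_scale mx_of_id scalemx1 Ma; congr _%:M.
by move/matrixP/(_ 0 0): Ma; rewrite !mxE => ->.
Qed.

Definition mpow (M : mat) n : mat := iter n (mmul M) id_mat.

(** The order is taken modulo scalars: the n-th power must be scalar, and no earlier positive power
    may be. *)
Definition mat_order (M : mat) n : bool :=
  [&& similar_bilin M, scalar_mat (mpow M n) &
      all (fun k => ~~ scalar_mat (mpow M k)) (iota 1 n.-1)].

Lemma mpow_unit M n : mx_of M \in unitmx -> mx_of (mpow M n) \in unitmx.
Proof.
move=> uM; elim: n => [|n IHn] /=; first by rewrite mx_of_id unitmx1.
by rewrite mx_ofM unitmx_mul uM.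
Qed.

Lemma clsX M n : mx_of M \in unitmx -> cls (mpow M n) = (cls M ^+ n)%g.
Proof.
move=> uM; elim: n => [|n IHn] /=; last by rewrite clsM ?mpow_unit // IHn expgS.
apply/eqP; rewrite expg0 cls_eq1 ?mx_of_id ?unitmx1 //.
Qed.

Lemma order_cls M n : mat_order M n -> (0 < n)%N -> #[cls M]%g = n.
Proof.
case/and3P => /similar_bilin_unit uM Mn1 /allP Mn n_gt0.
have clsX1 k : (cls M ^+ k == 1)%g = scalar_mat (mpow M k).
  by rewrite -clsX // cls_eq1 ?mpow_unit.
have := Mn1; rewrite -clsX1 -order_dvdn => /(dvdn_leq n_gt0).
rewrite leq_eqVlt => /orP[/eqP // | lt_n].
have: ~~ scalar_mat (mpow M #[cls M]%g).
  by apply: Mn; rewrite mem_iota add1n prednK // lt_n order_gt0.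
by rewrite -clsX1 expg_order eqxx.
Qed.


(** * The eight curves *)

Lemma idxE : (idx 0 = 0) * (idx 1 = 1) * (idx 2 = 2) * (idx 3 = 3).
Proof. by do !split; apply: ord_inj; rewrite /idx inordK. Qed.

Lemma rval1Z (p : {mpoly 'F_11[4]}) : rval R1 *: p = p.
Proof. exact: scale1r. Qed.

(** The sum over a list ends in 0, so a 0 is appended on the left before both sides are
    reassociated. *)
Ltac expand_cubic P C :=
  rewrite /cubic_mpoly /C !big_cons big_nil /= !idxE !rval1Z /P;
  rewrite !exprS !expr0 !mulr1 !mulrA -[LHS]addr0 -!addrA.

Lemma P1N1E : P1N1 = cubic_mpoly C1.
Proof. by expand_cubic P1N1 C1. Qed.

Lemma P2N1E : P2N1 = cubic_mpoly C2.
Proof. by expand_cubic P2N1 C2. Qed.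

Lemma P3N1E : P3N1 = cubic_mpoly C3.
Proof. by expand_cubic P3N1 C3. Qed.

Lemma P4N1E : P4N1 = cubic_mpoly C4.
Proof. by expand_cubic P4N1 C4. Qed.

Lemma P5N1E : P5N1 = cubic_mpoly C5.
Proof. by expand_cubic P5N1 C5. Qed.

Lemma P6N1E : P6N1 = cubic_mpoly C6.
Proof. by expand_cubic P6N1 C6. Qed.

Lemma P7N1E : P7N1 = cubic_mpoly C7.
Proof. by expand_cubic P7N1 C7. Qed.

Lemma P8N1E : P8N1 = cubic_mpoly C8.
Proof. by expand_cubic P8N1 C8. Qed.

(** Equips the set [curve_aut] with the group structure that the recognition lemmas expect. *)
Definition aut_group (s : cubic) : {group coset_of (@scalars 'F_11)} :=
  (lin_aut_QN1_group (cubic_mpoly s) / @scalars 'F_11)%G.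

Close Scope ring_scope.
Local Open Scope group_scope.

(** The matrices of the transpositions (0 k), which generate the symmetric group; k = 0 gives the
    identity. *)
Definition swap_mat (k : nat) : mat :=
  make4 (fun j => unit4 (if j == 0 then k else if j == k then 0 else j)).

Lemma mx_of_swap (k : 'I_4) : mx_of (swap_mat k) = perm_mx (tperm ord0 k).
Proof.
apply/matrixP => i j; rewrite !mxE permE /=.
by case: i j k => [[|[|[|[|//]]]] ?] [[|[|[|[|//]]]] ?] [[|[|[|[|//]]]] ?].
Qed.

(* The automorphisms permute the four columns of B. *)
Lemma isog_S4 s (B : mat) (t : nat -> mat) :
  mx_of B \in unitmx ->
  (forall k : 'I_4, cls (t k) \in aut_group s /\ similar_bilin (t k)) ->
  (forall k : 'I_4, mmul (t k) B = mmul B (swap_mat k)) ->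
  (#|aut_group s| <= 24)%N -> aut_group s \isog [set: 'S_4].
Proof.
move=> uB autT eqT leG.
have uP (p : 'S_4) : (perm_mx p : 'M['F_11]_4) \in unitmx by exact: unitmx_perm.
(* This is the class of B P B^-1, with P the matrix of p: the permutation matrices are read in the
   basis formed by the columns of B. *)
pose f (p : 'S_4) := coset (@scalars 'F_11) (GLof (perm_mx p)) ^ (cls B)^-1.
have fM : {in [set: 'S_4] &, {morph f : p q / p * q}}.
  move=> p q _ _; rewrite /f -conjMg -coset_scalarsM.
  by rewrite perm_mxM (GLofM (uP p) (uP q)).
pose phi := Morphism fM.
have inj_phi : 'injm phi.
  apply/subsetP => p /morphpreP[_]; rewrite inE => /eqP fp; rewrite inE.
  have: coset (@scalars 'F_11) (GLof (perm_mx p)) == 1.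
    by rewrite -(conjg_eq1 _ (cls B)^-1) -fp.
  rewrite coset_scalar_eq1 (GLof_val (uP p)) => /is_scalar_mxP[a pa].
  apply/eqP/permP => i; rewrite perm1; apply/eqP/contraT => pi_i.
  (* The permutation matrix has a 1 at (i, p i), where a scalar matrix has 0 when p i differs from
     i. *)
  move/matrixP/(_ i (p i)): (pa); rewrite !mxE eqxx eq_sym (negPf pi_i) => /eqP.
  by rewrite oner_eq0.
have im_phi : phi @* [set: 'S_4] \subset aut_group s.
  suff: phi @* <<[set tperm ord0 k | k in 'I_4]>> \subset aut_group s.
    by rewrite gen_tperm.
  rewrite morphim_gen ?subsetT // gen_subG.
  apply/subsetP => _ /morphimP[_ _ /imsetP[k _ ->] ->] /=.
  have [autk /similar_bilin_unit uk] := autT k.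
  suff -> : f (tperm ord0 k) = cls (t k) by [].
  (* Undoing the conjugation reduces the claim to the classes of the relation [eqT]. *)
  apply: (canLR (conjgKV _)); apply: (mulgI (cls B)).
  have uS : mx_of (swap_mat k) \in unitmx by rewrite mx_of_swap unitmx_perm.
  rewrite invgK -conjgC; transitivity (cls (mmul B (swap_mat k))).
    by rewrite (clsM uB uS) [cls (swap_mat k)]/cls mx_of_swap.
  by rewrite -eqT; apply: clsM.
(* An injective image of a group of order 24 fills a group of order at most 24. *)
have defG : phi @* [set: 'S_4] = aut_group s.
  have cardS : #|[set: 'S_4]| = 24 by rewrite cardsT card_Sn.
  by apply/eqP; rewrite eqEcard im_phi (card_injm inj_phi (subxx _)) cardS.
by rewrite -defG isog_sym; apply: sub_isog.
Qed.

(** Explicit automorphisms, by columns: a generator in the cyclic cases, two involutions in the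
    Klein and dihedral cases. For the eighth curve, [A8 k] exchanges columns 0 and k of [B8], whose
    columns are the four permuted points. *)
Definition A1 : mat :=
 ((R1, R7, R9, R3), (R2, R3, R9, R3), (R8, R8, R6, R5), (R6, R6, R5, R6)).
Definition A2 : mat :=
 ((R1, R0, R0, R0), (R0, R10, R0, R0), (R0, R0, R10, R0), (R0, R0, R0, R1)).
Definition A3x : mat :=
 ((R0, R0, R0, R1), (R0, R0, R10, R0), (R0, R10, R0, R0), (R1, R0, R0, R0)).
Definition A3y : mat :=
 ((R1, R1, R1, R10), (R1, R1, R10, R1), (R1, R10, R1, R1), (R10, R1, R1, R1)).
Definition A4 : mat :=
 ((R1, R1, R9, R2), (R5, R10, R1, R9), (R5, R5, R10, R1), (R8, R5, R5, R1)).
Definition A5 : mat :=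
 ((R0, R0, R1, R9), (R0, R0, R10, R4), (R8, R5, R5, R1), (R8, R10, R5, R2)).
Definition A6x : mat :=
 ((R1, R0, R0, R0), (R5, R0, R1, R0), (R6, R1, R0, R0), (R3, R6, R5, R1)).
Definition A6y : mat :=
 ((R1, R6, R8, R7), (R7, R10, R1, R8), (R5, R8, R10, R6), (R9, R5, R7, R1)).
Definition A7x : mat :=
 ((R1, R1, R4, R7), (R9, R9, R7, R4), (R5, R8, R9, R1), (R10, R5, R9, R1)).
Definition A7y : mat :=
 ((R1, R6, R3, R4), (R10, R10, R8, R3), (R4, R2, R10, R6), (R4, R4, R10, R1)).
Definition B8 : mat :=
 ((R1, R3, R0, R3), (R8, R7, R6, R2), (R3, R7, R7, R3), (R6, R5, R5, R0)).
Definition A8 (k : nat) : mat :=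
  match k with
  | 0 => id_mat
  | 1 => ((R4, R8, R1, R9), (R4, R8, R5, R1), (R10, R1, R8, R8), (R1, R10, R4, R4))
  | 2 => ((R1, R0, R0, R0), (R5, R0, R1, R0), (R6, R1, R0, R0), (R3, R6, R5, R1))
  | _ => ((R9, R1, R8, R4), (R5, R3, R5, R8), (R2, R3, R3, R1), (R5, R2, R5, R9))
  end.

Definition B8_inv : mat :=
 ((R6, R4, R6, R0), (R0, R1, R3, R10), (R6, R3, R3, R10), (R2, R5, R6, R1)).

Lemma card_aut_group s n : ceval s (unit4 0) = R0 -> (size (search s) <= n)%N ->
  (#|aut_group s| <= n)%N.
Proof. by move=> s0; apply: leq_trans (card_curve_aut s0). Qed.

Lemma isog_aut_cyclic s M r l n : (1 < n)%N -> ceval s (unit4 0) = R0 ->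
  certifies s M r l -> mat_order M n -> (size (search s) <= n)%N ->
  aut_group s \isog [set: 'Z_n].
Proof.
move=> n_gt1 s0 autM oM le_n; apply: (@isog_Zn _ _ (cls M)) => //.
- exact: cls_aut autM.
- exact: order_cls oM (ltnW n_gt1).
exact: card_aut_group.
Qed.

Definition involution_pair s M r l N r' l' n : bool :=
  [&& certifies s M r l, certifies s N r' l', mat_order M 2, mat_order N 2,
      mat_order (mmul M N) n & ceval s (unit4 0) == R0].

Lemma involution_pairP s M r l N r' l' n :
  (1 < n)%N -> involution_pair s M r l N r' l' n ->
  [/\ cls M \in aut_group s, cls N \in aut_group s,
      #[cls M] = 2, #[cls N] = 2 & #[cls M * cls N] = n].
Proof.
move=> n_gt1 /and5P[autM autN oM oN /andP[oMN _]].
split; [exact: cls_aut autM | exact: cls_aut autN | exact: order_cls oM _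
  | exact: order_cls oN _ |].
have [/and3P[/similar_bilin_unit uM _ _] /and3P[/similar_bilin_unit uN _ _]] := (oM, oN).
by rewrite -(clsM uM uN); apply: order_cls oMN (ltnW n_gt1).
Qed.

Lemma isog_aut_dihedral s M r l N r' l' n :
  (1 < n)%N -> involution_pair s M r l N r' l' n ->
  (size (search s) <= n.*2)%N -> aut_group s \isog 'D_n.*2.
Proof.
move=> n_gt1 pairMN le_n; have [Gx Gy ox oy oxy] := involution_pairP n_gt1 pairMN.
apply: (isog_dihedral Gx Gy ox oy oxy n_gt1).
by case/and5P: pairMN => _ _ _ _ /andP[_ /eqP s0]; apply: card_aut_group.
Qed.

Lemma isog_aut_Klein s M r l N r' l' :
  involution_pair s M r l N r' l' 2 ->
  (size (search s) <= 4)%N -> aut_group s \isog setX [set: 'Z_2] [set: 'Z_2].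
Proof.
move=> pairMN le_n; have [Gx Gy ox oy oxy] := involution_pairP (isT : (1 < 2)%N) pairMN.
apply: (isog_Klein Gx Gy ox oy oxy) => //.
by case/and5P: pairMN => _ _ _ _ /andP[_ /eqP s0]; apply: card_aut_group.
Qed.

(** Coefficients of the linear form L in g.P - P = L Q for g = [A8 k]; the factor r is 1 in all four
    cases. *)
Definition A8_cofactor (k : nat) : vec :=
  match k with
  | 0 => (R0, R0, R0, R0)
  | 1 => (R6, R8, R9, R2)
  | 2 => (R0, R8, R3, R7)
  | _ => (R1, R2, R3, R2)
  end.

Lemma aut_group8 : aut_group C8 \isog [set: 'S_4].
Proof.
apply: (@isog_S4 _ B8 A8).
- have B8K : mmul B8_inv B8 = id_mat by apply/eqP; vm_compute.
  by have := mx_ofM B8_inv B8; rewrite B8K mx_of_id => /esym/mulmx1_unit[].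
- move=> k; have certk : certifies C8 (A8 k) R1 (A8_cofactor k).
    by case: k => [[|[|[|[|//]]]] ?]; vm_compute.
  by split; [exact: cls_aut certk | case/and3P: certk].
- by case=> [[|[|[|[|//]]]] ?]; apply/eqP; vm_compute.
by apply: (@card_aut_group C8 24 erefl); vm_compute.
Qed.

(* 'D_m denotes the dihedral group of order m. *)
Theorem theorem4p1p1 :
  [/\ curve_aut QN1 P1N1 \isog [set: 'Z_6],
      curve_aut QN1 P2N1 \isog [set: 'Z_2],
      curve_aut QN1 P3N1 \isog 'D_8 &
      curve_aut QN1 P4N1 \isog [set: 'Z_2]] /\
  [/\ curve_aut QN1 P5N1 \isog [set: 'Z_3],
      curve_aut QN1 P6N1 \isog setX [set: 'Z_2] [set: 'Z_2],
      curve_aut QN1 P7N1 \isog 'D_12 &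
      curve_aut QN1 P8N1 \isog [set: 'S_4]].
Proof.
rewrite P1N1E P2N1E P3N1E P4N1E P5N1E P6N1E P7N1E P8N1E; split; split.
(* Each automorphism comes with its factor r and the coefficients of L. In the dihedral cases the
   last argument is the order of the product of the two involutions, half the group order. *)
- by apply: (@isog_aut_cyclic C1 A1 R7 (R3, R5, R2, R2)); vm_compute.
- by apply: (@isog_aut_cyclic C2 A2 R10 (R0, R0, R0, R0)); vm_compute.
- by apply: (@isog_aut_dihedral C3 A3x R1 (R0, R0, R0, R0)
    A3y R8 (R0, R0, R0, R0) 4); vm_compute.
- by apply: (@isog_aut_cyclic C4 A4 R10 (R2, R0, R10, R10)); vm_compute.
- by apply: (@isog_aut_cyclic C5 A5 R2 (R4, R7, R3, R9)); vm_compute.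
- by apply: (@isog_aut_Klein C6 A6x R1 (R0, R8, R3, R7)
    A6y R7 (R8, R7, R9, R4)); vm_compute.
- by apply: (@isog_aut_dihedral C7 A7x R10 (R3, R8, R2, R4)
    A7y R1 (R5, R7, R0, R9) 6); vm_compute.
exact: aut_group8.
Qed.
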